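(* Let $y\in\mathbb{R}^n$, let $Z$ be an $n\times p$ real matrix, $\widehat D$ a $p\times p$ real diagonal matrix, $\mu,\tau>0$, and $\Theta\subset\mathbb{R}^p$. Put $S(\theta)=\frac1nZ^T(y-Z\theta)+\widehat D\theta$ and, for $r\ge0$, $$\mathcal{U}_r=\{\theta\in\Theta:\ |S(\theta)|_\infty\le\mu r+\tau\},\qquad \varphi(r)=\min_{\theta\in\mathcal{U}_r}|\theta|_1 .$$ Consider the two problems: (P) minimise $|\theta|_1$ over $\theta\in\Theta$ such that $|S(\theta)|_\infty\le\mu|\theta|_1+\tau$; (Q) minimise $t$ over $(t,\theta^+,\theta^-)\in\mathbb{R}\times\mathbb{R}^p\times\mathbb{R}^p$ such that $\theta^+-\theta^-\in\Theta$, $\theta_j^+\ge0$, $\theta_j^-\ge0$ for $j=1,\dots,p$, $t=\sum_{j=1}^p(\theta_j^++\theta_j^-)$, and $|S(\theta^+-\theta^-)|_\infty\le\mu t+\tau$. Assume that there exists a solution $\bar r\ge0$ to the equation $r=\varphi(r)$. Let $(\hat t,\hat\theta^+,\hat\theta^-)$ be a solution of (Q) and set $\hat\theta^{C'}=\hat\theta^+-\hat\theta^-$. Then $\hat\theta^{C'}$ is a solution of the minimisation problem (P). Moreover, any solution $\hat\theta^C$ of (P) induces a solution $(\bar r,\theta^+,\theta^-)$ of the problem (Q), where $\theta^+$ and $\theta^-$ are the vectors with components $\theta_j^+=\max\{\hat\theta_j^C,0\}$ and $\theta_j^-=\max\{-\hat\theta_j^C,0\}$.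
   Context: $|\cdot|_1$ and $|\cdot|_\infty$ are the $\ell_1$ and $\ell_\infty$ norms on $\mathbb{R}^p$. A minimum over an empty set is $+\infty$; the equation $\bar r=\varphi(\bar r)$ means that the minimum defining $\varphi(\bar r)$ is attained and equals the finite number $\bar r$. Problem (P) defines the so-called compensated MU selector; (Q) is a convex program when $\Theta$ is convex, and a linear program when $\Theta=\mathbb{R}^p$ or $\Theta$ is defined by linear constraints. *)

(* Defs.v *)
From mathcomp Require Import all_boot all_order all_algebra.
From mathcomp Require Import all_classical all_reals all_analysis.

Set Implicit Arguments.
Unset Strict Implicit.
Unset Printing Implicit Defensive.

Import Order.TTheory GRing.Theory Num.Theory.
Import numFieldNormedType.Exports.

Local Open Scope classical_set_scope.
Local Open Scope ring_scope.

Definition minimizer (R : realType) (T : Type) (F : set T) (f : T -> R)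
    (x : T) : Prop :=
  F x /\ forall x', F x' -> f x <= f x'.

Definition l1norm (R : realType) (p : nat) (x : 'cV[R]_p) : R :=
  \sum_(j < p) `|x j 0|.

Definition pos_part (R : realType) (p : nat) (x : 'cV[R]_p) : 'cV[R]_p :=
  \col_j Num.max (x j 0) 0.

Definition neg_part (R : realType) (p : nat) (x : 'cV[R]_p) : 'cV[R]_p :=
  \col_j Num.max (- x j 0) 0.

Section CompensatedMU.
Context (R : realType) (n p : nat).
Context (y : 'cV[R]_n) (Z : 'M[R]_(n, p)) (D : 'M[R]_p).
Context (mu tau : R) (Theta : set 'cV[R]_p).

Definition score (theta : 'cV[R]_p) : 'cV[R]_p :=
  n%:R^-1 *: (Z^T *m (y - Z *m theta)) + D *m theta.

(* The norm [`|_|] on matrices is the largest absolute value of an entry,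
   hence the sup norm on column vectors. *)
Definition mu_set (r : R) : set 'cV[R]_p :=
  [set theta | Theta theta /\ `|score theta| <= mu * r + tau].

(* The infimum in [\bar R] is [+oo] on the empty set; whether it is attained
   is a separate condition, imposed in [phi_fixpoint]. *)
Definition phi (r : R) : \bar R :=
  ereal_inf [set (l1norm theta)%:E | theta in mu_set r].

Definition phi_fixpoint (r : R) : Prop :=
  [/\ 0 <= r, r%:E = phi r &
      exists2 theta, mu_set r theta & (l1norm theta)%:E = phi r].

Definition feasible_P : set 'cV[R]_p :=
  [set theta | Theta theta /\ `|score theta| <= mu * l1norm theta + tau].

Definition solution_P (theta : 'cV[R]_p) : Prop :=
  minimizer feasible_P (@l1norm R p) theta.

Definition feasible_Q : set (R * 'cV[R]_p * 'cV[R]_p) :=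
  [set q | let: (t, thp, thm) := q in
    [/\ Theta (thp - thm),
        (forall j, 0 <= thp j 0),
        (forall j, 0 <= thm j 0),
        t = \sum_(j < p) (thp j 0 + thm j 0) &
        `|score (thp - thm)| <= mu * t + tau]].

Definition solution_Q (q : R * 'cV[R]_p * 'cV[R]_p) : Prop :=
  minimizer feasible_Q (fun q' => q'.1.1) q.

End CompensatedMU.

(* Main.v *)
Require Import Defs.
From mathcomp Require Import all_boot all_order all_algebra.
From mathcomp Require Import all_classical all_reals all_analysis.

Set Implicit Arguments.
Unset Strict Implicit.
Unset Printing Implicit Defensive.

Import Order.TTheory GRing.Theory Num.Theory.
Import numFieldNormedType.Exports.

Local Open Scope classical_set_scope.
Local Open Scope ring_scope.

(** A fixed point [rbar] of [phi] is the common optimal value of (P) and (Q).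

    It bounds (Q) from below ([phi_fixpoint_le_Q]): if a feasible point of (Q)
    had [t < rbar], the constraint at level [t] would be stricter than the one
    at level [rbar], because [mu >= 0]; so [thp - thm] would compete in the
    minimum defining [phi rbar], whence [rbar <= l1norm (thp - thm) <= t].
    Splitting a vector into its positive and negative parts turns feasible
    points of (P) into feasible points of (Q) with the same objective, so
    [rbar] bounds (P) from below as well.  Both bounds are reached at a vector
    attaining [phi rbar], whose norm is exactly [rbar].

    A solution of (Q) therefore has [t = rbar], and the same competition
    argument forces [l1norm (thp - thm) = t]: the constraint of (Q) becomes
    that of (P), and [thp - thm] has the optimal norm.  Conversely a solution
    of (P) has norm [rbar], and its splitting is feasible for (Q) with the
    optimal objective. *)

Lemma pos_partBneg_part (R : realType) (p : nat) (x : 'cV[R]_p) :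
  pos_part x - neg_part x = x.
Proof.
apply/colP => j; rewrite !mxE.
have /orP[xj|xj] := le_total 0 (x j 0).
  by rewrite max_l // max_r ?oppr_le0 // subr0.
by rewrite max_r // max_l ?oppr_ge0 // sub0r opprK.
Qed.

Lemma l1norm_pos_neg_part (R : realType) (p : nat) (x : 'cV[R]_p) :
  l1norm x = \sum_(j < p) (pos_part x j 0 + neg_part x j 0).
Proof.
apply: eq_bigr => j _; rewrite !mxE.
have /orP[xj|xj] := le_total 0 (x j 0).
  by rewrite ger0_norm // max_l // max_r ?oppr_le0 // addr0.
by rewrite ler0_norm // max_r // max_l ?oppr_ge0 // add0r.
Qed.

Lemma l1normB_le (R : realType) (p : nat) (u v : 'cV[R]_p) :
  (forall j, 0 <= u j 0) -> (forall j, 0 <= v j 0) ->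
  l1norm (u - v) <= \sum_(j < p) (u j 0 + v j 0).
Proof.
move=> u0 v0; apply: ler_sum => j _; rewrite !mxE.
by rewrite (le_trans (ler_normB _ _))// !ger0_norm.
Qed.

Section FixedPoint.
Context (R : realType) (n p : nat).
Context (y : 'cV[R]_n) (Z : 'M[R]_(n, p)) (D : 'M[R]_p).
Context (mu tau : R) (Theta : set 'cV[R]_p).

Lemma phi_fixpoint_le (rbar : R) (theta : 'cV[R]_p) :
  phi_fixpoint y Z D mu tau Theta rbar ->
  mu_set y Z D mu tau Theta rbar theta -> rbar <= l1norm theta.
Proof.
case=> _ rphi _ Utheta; rewrite -lee_fin rphi.
by apply: ereal_inf_lbound; exists theta.
Qed.

Lemma phi_fixpoint_attained (rbar : R) :
  phi_fixpoint y Z D mu tau Theta rbar ->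
  exists2 theta, feasible_P y Z D mu tau Theta theta & l1norm theta = rbar.
Proof.
case=> _ rphi [theta [Ttheta Stheta]]; rewrite -rphi => -[normE].
by exists theta => //; split; rewrite ?normE.
Qed.

Lemma mu_set_subset (r s : R) : 0 <= mu -> r <= s ->
  mu_set y Z D mu tau Theta r `<=` mu_set y Z D mu tau Theta s.
Proof.
move=> mu0 rs theta [Ttheta Stheta]; split => //.
by rewrite (le_trans Stheta)// lerD2r ler_wpM2l.
Qed.

Lemma feasible_P_Q (theta : 'cV[R]_p) :
  feasible_P y Z D mu tau Theta theta ->
  feasible_Q y Z D mu tau Theta
    (l1norm theta, pos_part theta, neg_part theta).
Proof.
case=> Ttheta Stheta; split; rewrite ?pos_partBneg_part //.
- by move=> j; rewrite mxE le_max lexx orbT.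
- by move=> j; rewrite mxE le_max lexx orbT.
- exact: l1norm_pos_neg_part.
Qed.

(** A point of (Q) with [t <= rbar] competes in the minimum defining [phi rbar],
    since the constraint sets grow with the level. *)
Lemma phi_fixpoint_le_Q (rbar t : R) (thp thm : 'cV[R]_p) : 0 <= mu ->
  phi_fixpoint y Z D mu tau Theta rbar ->
  feasible_Q y Z D mu tau Theta (t, thp, thm) -> rbar <= t.
Proof.
move=> mu0 fix_r [Tth thp0 thm0 tE Sth].
have /orP[//|t_le_r] := le_total rbar t.
have U : mu_set y Z D mu tau Theta rbar (thp - thm).
  by apply: mu_set_subset t_le_r _ _.
by rewrite (le_trans (phi_fixpoint_le fix_r U))// tE l1normB_le.
Qed.

Lemma phi_fixpoint_le_P (rbar : R) (theta : 'cV[R]_p) : 0 <= mu ->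
  phi_fixpoint y Z D mu tau Theta rbar ->
  feasible_P y Z D mu tau Theta theta -> rbar <= l1norm theta.
Proof. by move=> mu0 fix_r /feasible_P_Q; apply: phi_fixpoint_le_Q. Qed.

Lemma solution_P_norm (rbar : R) (theta : 'cV[R]_p) : 0 <= mu ->
  phi_fixpoint y Z D mu tau Theta rbar ->
  solution_P y Z D mu tau Theta theta -> l1norm theta = rbar.
Proof.
move=> mu0 fix_r [Ptheta min_theta]; apply/le_anti/andP; split.
  by have [theta0 /min_theta + <-] := phi_fixpoint_attained fix_r.
exact: phi_fixpoint_le_P Ptheta.
Qed.

Lemma solution_Q_value (rbar t : R) (thp thm : 'cV[R]_p) : 0 <= mu ->
  phi_fixpoint y Z D mu tau Theta rbar ->
  solution_Q y Z D mu tau Theta (t, thp, thm) -> t = rbar.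
Proof.
move=> mu0 fix_r [Qt min_t]; apply/le_anti/andP; split.
  by have [theta0 /feasible_P_Q/min_t + <-] := phi_fixpoint_attained fix_r.
exact: phi_fixpoint_le_Q Qt.
Qed.

End FixedPoint.

Theorem theorem4 (R : realType) (n p : nat) (hn : (0 < n)%N)
    (y : 'cV[R]_n) (Z : 'M[R]_(n, p)) (D : 'M[R]_p) (hD : is_diag_mx D)
    (mu tau : R) (hmu : 0 < mu) (htau : 0 < tau) (Theta : set 'cV[R]_p)
    (rbar : R) (hrbar : phi_fixpoint y Z D mu tau Theta rbar) :
  (forall (t : R) (thp thm : 'cV[R]_p),
     solution_Q y Z D mu tau Theta (t, thp, thm) ->
     solution_P y Z D mu tau Theta (thp - thm)) /\
  (forall theta : 'cV[R]_p,
     solution_P y Z D mu tau Theta theta ->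
     solution_Q y Z D mu tau Theta (rbar, pos_part theta, neg_part theta)).
Proof.
have mu0 := ltW hmu; split=> [t thp thm solQ|theta solP].
  have tE := solution_Q_value mu0 hrbar solQ.
  case: solQ => -[Tth thp0 thm0 sumE Sth] _; rewrite tE in sumE Sth.
  (* [thp] and [thm] cannot overlap: otherwise [thp - thm] would have a norm
     below [rbar] while lying in the constraint set at level [rbar]. *)
  have normE : l1norm (thp - thm) = rbar.
    apply/le_anti; rewrite (phi_fixpoint_le hrbar) // andbT.
    by rewrite [leRHS]sumE l1normB_le.
  split=> [|theta' Ptheta']; first by split; rewrite ?normE.
  by rewrite normE (phi_fixpoint_le_P mu0 hrbar).
have [Ptheta _] := solP.
rewrite -(solution_P_norm mu0 hrbar solP).
split=> [|[[t' thp'] thm'] Q']; first exact: feasible_P_Q.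
by rewrite /= (solution_P_norm mu0 hrbar solP) (phi_fixpoint_le_Q mu0 hrbar Q').
Qed.
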